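(* Let the functions $\mathrm{MinC}$, $\mathrm{MaxUR}$, $\mathrm{MaxDR}$ be defined (on the sets of nonnegative requirements $f^u,f^d$ and budgets $\theta$ for which the respective linear programs are feasible) as in the context. Then: (a) $\mathrm{MinC}(f^u,f^d)$ is continuous, piecewise linear and convex as a function of both arguments $(f^u,f^d)$, and it is non-decreasing in $f^u$ and non-decreasing in $f^d$. (b) $\mathrm{MaxUR}(\theta,f^d)$ is continuous, piecewise linear and concave as a function of both arguments $(\theta,f^d)$; it is non-decreasing in $\theta$ and non-increasing in $f^d$. (c) $\mathrm{MaxDR}(\theta,f^u)$ is continuous, piecewise linear and concave as a function of both arguments $(\theta,f^u)$; it is non-decreasing in $\theta$ and non-increasing in $f^u$.
   Context: Data. $\mathcal N$ is a finite set of generators. For each $n\in\mathcal N$ the following real numbers are given: an energy bid $C_n$, minimal and maximal generation capacities $\underline g_n\le\bar g_n$, a ramping limit $\Delta g_n\ge 0$, and an initial output $g_{n,-1}$. There are two time steps $t\in\{0,1\}$. Also given are a transmission line capacity vector $\boldsymbol b$, real generation and load shift factor matrices $H_g,H_d$, and predicted demand vectors $\hat{\boldsymbol d}_0,\hat{\boldsymbol d}_1$ (of compatible dimensions). $\boldsymbol 1$ denotes an all-ones column vector of appropriate dimension. Variables. $g_{n,t}$ ($n\in\mathcal N$, $t=0,1$) are the power outputs, with $\boldsymbol g_t=(g_{n,t})_{n\in\mathcal N}$; $r^u_{n,1},r^d_{n,1}$ ($n\in\mathcal N$) are the up and down flexible ramping capacities at time $1$. There are no ramping variables at times before $1$: $r^u_{n,t}=r^d_{n,t}=0$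 for $t\in\{-1,0\}$. Base constraints (vector inequalities are componentwise): - $-\boldsymbol b\le H_g\boldsymbol g_t-H_d\hat{\boldsymbol d}_t\le\boldsymbol b$ for $t=0,1$; - $\boldsymbol 1^T\boldsymbol g_t-\boldsymbol 1^T\hat{\boldsymbol d}_t=0$ for $t=0,1$; - $\underline g_n\le g_{n,t}+r^u_{n,t}\le\bar g_n$ and $\underline g_n\le g_{n,t}-r^d_{n,t}\le\bar g_n$ for all $n$ and $t=0,1$; - $|g_{n,t+1}-g_{n,t}+r^u_{n,t+1}+r^d_{n,t}|\le\Delta g_n$ and $|g_{n,t+1}-g_{n,t}-r^d_{n,t+1}-r^u_{n,t}|\le\Delta g_n$ for all $n$ and $t=-1,0$; - $g_{n,t}\ge0$ for all $n$ and $t=0,1$; $r^u_{n,1}\ge0$, $r^d_{n,1}\ge0$ for all $n$. The three parametric functions (for $f^u,f^d\ge 0$): - $\mathrm{MinC}(f^u,f^d)$ is the minimum of $\sum_{t=0}^1\sum_{n\in\mathcal N}C_ng_{n,t}$ subject to the base constraints together with $\sum_n r^u_{n,1}=f^u$ and $\sum_n r^d_{n,1}=f^d$. - $\mathrm{MaxUR}(\theta,f^d)$ is the maximum of $\sum_n r^u_{n,1}$ subject to the base constraints together with $\sum_{t=0}^1\sum_n C_ng_{n,t}\le\theta$ and $\sum_n r^d_{n,1}=f^d$. - $\mathrm{MaxDR}(\theta,f^u)$ is the maximum of $\sum_n r^d_{n,1}$ subject to the base constraints together with $\sum_{t=0}^1\sum_n C_ng_{n,t}\le\theta$ and $\sum_n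 r^u_{n,1}=f^u$. It is assumed that the base problem is feasible for $f^u=f^d=0$. Each function is considered on the set of arguments for which its defining problem is feasible. ''Piecewise linear'' means that the domain is a finite union of polyhedra on each of which the function is affine. *)

(* Defs.v *)
From HB Require Import structures.
From mathcomp Require Import all_boot all_order all_algebra.
From mathcomp Require Import boolp classical_sets functions reals topology.
From mathcomp Require Import normedtype convex.

Set Implicit Arguments.
Unset Strict Implicit.
Unset Printing Implicit Defensive.
Import Order.TTheory GRing.Theory Num.Theory.
Import numFieldNormedType.Exports.
Local Open Scope classical_set_scope.
Local Open Scope ring_scope.

(* The plane of arguments; [R^o] makes the product an [lmodType R]. *)
Notation plane R := (R^o * R^o)%type.

Section Functions_on_the_plane.
Variable R : realType.
Implicit Types (D P : set (plane R)) (f : plane R -> R).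

(* A finite intersection of closed half-planes; k = 0 gives the whole plane. *)
Definition polyhedron P : Prop :=
  exists (k : nat) (a b c : 'I_k -> R),
    P = [set x | forall i, a i * x.1 + b i * x.2 <= c i].

Definition affine_on P f : Prop :=
  exists a b c : R, forall x, P x -> f x = a * x.1 + b * x.2 + c.

Definition piecewise_linear_on D f : Prop :=
  exists (k : nat) (P : 'I_k -> set (plane R)),
    D = \bigcup_(i in [set: 'I_k]) P i /\
    forall i, polyhedron (P i) /\ affine_on (P i) f.

(* The library's [convex_function] does not ask the domain to be convex. *)
Definition convex_on D f : Prop :=
  convex_set (D : set (convex_lmodType (plane R))) /\
  convex_function (D : set (convex_lmodType (plane R))) f.

Definition concave_on D f : Prop := convex_on D (fun x => - f x).

Definition nondecreasing_arg1 D f : Prop := forall x x' y,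
  D (x, y) -> D (x', y) -> x <= x' -> f (x, y) <= f (x', y).

Definition nondecreasing_arg2 D f : Prop := forall x y y',
  D (x, y) -> D (x, y') -> y <= y' -> f (x, y) <= f (x, y').

Definition nonincreasing_arg2 D f : Prop := forall x y y',
  D (x, y) -> D (x, y') -> y <= y' -> f (x, y') <= f (x, y).

End Functions_on_the_plane.

Section Extrema.
Variable R : realType.
Implicit Types (A : set R) (v : R).

(* [minimum A] and [maximum A] are 0 when the extremum does not exist. The
   feasible sets below are compact, so this never happens on the domains of
   [MinC], [MaxUR] and [MaxDR]. *)
Definition minimum A : R := xget 0 (A `&` lbound A).
Definition maximum A : R := xget 0 (A `&` ubound A).

Lemma minimumE A v : A v -> lbound A v -> minimum A = v.
Proof.
move=> Av lv; apply: xget_unique => // w [Aw lw].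
by apply/le_anti; rewrite (lw _ Av) (lv _ Aw).
Qed.

Lemma maximumE A v : A v -> ubound A v -> maximum A = v.
Proof.
move=> Av uv; apply: xget_unique => // w [Aw uw].
by apply/le_anti; rewrite (uw _ Av) (uv _ Aw).
Qed.

End Extrema.

(* N generators, L lines, D loads. *)
Record network (R : realType) (N L D : nat) := Network {
  bid : 'cV[R]_N;
  gmin : 'cV[R]_N;
  gmax : 'cV[R]_N;
  ramp_limit : 'cV[R]_N;
  ginit : 'cV[R]_N;        (* outputs at time -1 *)
  line_cap : 'cV[R]_L;
  Hg : 'M[R]_(L, N);
  Hd : 'M[R]_(L, D);
  demand0 : 'cV[R]_D;
  demand1 : 'cV[R]_D }.

Record dispatch (R : realType) (N : nat) := Dispatch {
  gen0 : 'cV[R]_N;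
  gen1 : 'cV[R]_N;
  rup1 : 'cV[R]_N;
  rdown1 : 'cV[R]_N }.

Section Problems.
Variables (R : realType) (N L D : nat) (I : network R N L D).
Implicit Types (x : dispatch R N) (t : int).

(* Meaningful for t = 0, 1. *)
Definition demand t : 'cV[R]_D := if t == 0 then demand0 I else demand1 I.

(* Meaningful for t = -1, 0, 1. *)
Definition gen x t : 'cV[R]_N :=
  if t == -1 then ginit I else if t == 0 then gen0 x else gen1 x.

(* There is no ramping capacity before time 1. *)
Definition rup x t : 'cV[R]_N := if t == 1 then rup1 x else 0.
Definition rdown x t : 'cV[R]_N := if t == 1 then rdown1 x else 0.

Definition line_constraints x t : Prop := forall l : 'I_L,
  - line_cap I l 0 <= (Hg I *m gen x t - Hd I *m demand t) l 0
    <= line_cap I l 0.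

Definition balance_constraint x t : Prop :=
  \sum_n gen x t n 0 - \sum_j demand t j 0 = 0.

Definition capacity_constraints x t : Prop := forall n : 'I_N,
  (gmin I n 0 <= gen x t n 0 + rup x t n 0 <= gmax I n 0) /\
  (gmin I n 0 <= gen x t n 0 - rdown x t n 0 <= gmax I n 0).

Definition ramping_constraints x t : Prop := forall n : 'I_N,
  (`|gen x (t + 1) n 0 - gen x t n 0 + rup x (t + 1) n 0 + rdown x t n 0|
     <= ramp_limit I n 0) /\
  (`|gen x (t + 1) n 0 - gen x t n 0 - rdown x (t + 1) n 0 - rup x t n 0|
     <= ramp_limit I n 0).

Definition sign_constraints x : Prop := forall n : 'I_N,
  [/\ 0 <= gen x 0 n 0, 0 <= gen x 1 n 0,
      0 <= rup x 1 n 0 & 0 <= rdown x 1 n 0].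

Definition base_constraints x : Prop :=
  [/\ forall t, t \in [:: 0; 1] -> line_constraints x t,
      forall t, t \in [:: 0; 1] -> balance_constraint x t,
      forall t, t \in [:: 0; 1] -> capacity_constraints x t,
      forall t, t \in [:: -1; 0] -> ramping_constraints x t &
      sign_constraints x].

Definition cost x : R :=
  \sum_(t <- [:: 0; 1]) \sum_n bid I n 0 * gen x t n 0.

Definition total_up x : R := \sum_n rup x 1 n 0.
Definition total_down x : R := \sum_n rdown x 1 n 0.

(* Arguments are (f^u, f^d). *)
Definition MinC_feasible (p : plane R) : set (dispatch R N) :=
  [set x | [/\ base_constraints x, total_up x = p.1 & total_down x = p.2]].

Definition MinC_dom : set (plane R) :=
  [set p | [/\ 0 <= p.1, 0 <= p.2 & MinC_feasible p !=set0]].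

Definition MinC (p : plane R) : R := minimum (cost @` MinC_feasible p).

(* Arguments are (theta, f^d). *)
Definition MaxUR_feasible (p : plane R) : set (dispatch R N) :=
  [set x | [/\ base_constraints x, cost x <= p.1 & total_down x = p.2]].

Definition MaxUR_dom : set (plane R) :=
  [set p | 0 <= p.2 /\ MaxUR_feasible p !=set0].

Definition MaxUR (p : plane R) : R := maximum (total_up @` MaxUR_feasible p).

(* Arguments are (theta, f^u). *)
Definition MaxDR_feasible (p : plane R) : set (dispatch R N) :=
  [set x | [/\ base_constraints x, cost x <= p.1 & total_up x = p.2]].

Definition MaxDR_dom : set (plane R) :=
  [set p | 0 <= p.2 /\ MaxDR_feasible p !=set0].

Definition MaxDR (p : plane R) : R := maximum (total_down @` MaxDR_feasible p).

End Problems.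

(* Main.v *)
Require Import Defs.
From mathcomp Require Import all_boot all_order all_algebra.
From mathcomp Require Import boolp classical_sets functions reals topology.
From mathcomp Require Import normedtype convex.
From mathcomp Require Import interval_inference ring lra.
Import Order.TTheory GRing.Theory Num.Theory.
Import numFieldNormedType.Exports.
Local Open Scope classical_set_scope.
Local Open Scope ring_scope.

Set Implicit Arguments.
Unset Strict Implicit.
Unset Printing Implicit Defensive.

(** Each of the three functions is the optimal value of a linear program whose
two parameters occur in the right-hand sides of the constraints.  After a change
of sign in the maximization problems, the triples (p, v) such that some dispatch
feasible for p has objective at most v form the projection of a polyhedron.  By
Fourier-Motzkin elimination ([fourier_motzkin], [polyhedral_projection]) such a
projection is again cut out by finitely many inequalities
    a_i p_1 + b_i p_2 + c_i v <= d_i.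

These inequalities give all the regularity claims.  The objectives are bounded on
the base constraints, so for a feasible p the admissible v form a closed
half-line, whose endpoint is the optimal value and is attained
([half_line_minimum], [minimum_attained]).  The set of triples is therefore the
epigraph of the value function on its domain.  It is convex, which gives
convexity of the domain and of the function.  An inequality with c_i < 0 bounds
v from below by an affine function of p, the i-th piece, and the value function
is the maximum of these pieces.  The part of the domain on which the i-th piece
is maximal is found by substituting this piece for v in the inequalities, hence
it is a polyhedron ([epigraph_piecewise_linear]); and a finite maximum of
continuous functions is continuous ([epigraph_continuous]).

Monotonicity in the budget is the inclusion of feasible sets.  Monotonicity in a
ramping requirement rests on [shrink_reserves_base]: multiplying the up (or the
down) ramping capacities of a dispatch by a factor in [0, 1] keeps it feasible
and changes neither its cost nor its other total capacity. *)

(** * Fourier-Motzkin elimination *)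

Section FourierMotzkin.
Variable R : realType.

(** A system of bounds [a i * t <= b i] on one number t is solvable as soon as
every lower bound (a negative coefficient) lies below every upper bound (a
positive coefficient), and the bounds without t hold.  The rows of E are these
conditions, cleared of denominators and indexed by pairs of inequalities. *)
Lemma eliminate_variable m (a : 'cV[R]_m) :
  exists k (E : 'M[R]_(k, m)), forall b : 'cV[R]_m,
    (exists t, forall i, a i 0 * t <= b i 0) <->
    (forall j, 0 <= (E *m b) j 0).
Proof.
pose e (ij : 'I_m * 'I_m) : 'rV[R]_m :=
  if a ij.1 0 == 0 then delta_mx 0 ij.1
  else if (0 < a ij.1 0) && (a ij.2 0 < 0)
       then a ij.1 0 *: delta_mx 0 ij.2 - a ij.2 0 *: delta_mx 0 ij.1
       else 0.
(* pairs that express no condition give the trivial row 0 *)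
pose E : 'M[R]_(#|{: 'I_m * 'I_m}|, m) := \matrix_r e (enum_val r).
exists _, E => b.
have deltaE i : ((delta_mx 0 i : 'rV[R]_m) *m b) 0 0 = b i 0.
  by rewrite -rowE mxE.
have entryE r : (E *m b) r 0 = (e (enum_val r) *m b) 0 0.
  transitivity (row r (E *m b) 0 0); first by rewrite [RHS]mxE.
  by rewrite row_mul rowK.
have mixE i j : ((a i 0 *: delta_mx 0 j - a j 0 *: delta_mx 0 i : 'rV[R]_m)
    *m b) 0 0 = a i 0 * b j 0 - a j 0 * b i 0.
  by rewrite mulmxBl -!scalemxAl mxE [X in _ + X]mxE mxE deltaE mxE deltaE.
have -> : (forall r, 0 <= (E *m b) r 0) <->
    (forall ij, 0 <= (e ij *m b) 0 0).
  split=> [h ij | h r]; last by rewrite entryE.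
  by have := h (enum_rank ij); rewrite entryE enum_rankK.
split=> [[t tP] [i j] | eP].
  rewrite /e /=; case: eqP => [ai0 | _].
    by rewrite deltaE; have := tP i; rewrite ai0 mul0r.
  case: andP => [[ai aj] | _]; last by rewrite mul0mx mxE.
  rewrite mixE; have := tP i; have := tP j => tj ti.
  have := ler_wpM2l (ltW ai) tj; have := ler_wnM2l (ltW aj) ti; lra.
have zeroP i : a i 0 = 0 -> 0 <= b i 0.
  by move=> ai; have := eP (i, i); rewrite /e /= ai eqxx deltaE.
have mixP i j : 0 < a i 0 -> a j 0 < 0 -> a j 0 * b i 0 <= a i 0 * b j 0.
  move=> ai aj; have := eP (i, j).
  by rewrite /e /= gt_eqF// ai aj mixE subr_ge0.
case: (pickP (fun i => 0 < a i 0)) => [i0 ai0 | npos].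
  (* the largest t that respects all the upper bounds *)
  pose i := [arg min_(i < i0 | 0 < a i 0) (b i 0 / a i 0)]%O.
  have [ai imin] : 0 < a i 0 /\
      forall j, 0 < a j 0 -> b i 0 / a i 0 <= b j 0 / a j 0.
    by rewrite /i; case: arg_minP.
  exists (b i 0 / a i 0) => j; case: (ltgtP (a j 0) 0) => aj.
  - by rewrite mulrA ler_pdivrMr// [leRHS]mulrC; exact: mixP.
  - by rewrite mulrC -ler_pdivlMr//; exact: imin.
  - by rewrite aj mul0r zeroP.
case: (pickP (fun i => a i 0 < 0)) => [i0 ai0 | nneg].
  pose i := [arg max_(i > i0 | a i 0 < 0) (b i 0 / a i 0)]%O.
  have [ai imax] : a i 0 < 0 /\
      forall j, a j 0 < 0 -> b j 0 / a j 0 <= b i 0 / a i 0.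
    by rewrite /i; case: arg_maxP.
  exists (b i 0 / a i 0) => j; case: (ltgtP (a j 0) 0) => aj.
  - by rewrite mulrC -ler_ndivrMr//; exact: imax.
  - by have := npos j; rewrite aj.
  - by rewrite aj mul0r zeroP.
exists 0 => j; rewrite mulr0; apply: zeroP.
by case: (ltgtP (a j 0) 0) => // aj; [have := nneg j | have := npos j];
  rewrite aj.
Qed.

(** The matrix Y serves all right-hand sides b at once.  This uniformity lets the
induction move the terms in the remaining variables to the right-hand side, and
later does the same with the parameters of a linear program. *)
Lemma fourier_motzkin m n (A : 'M[R]_(m, n)) :
  exists k (Y : 'M[R]_(k, m)), forall b : 'cV[R]_m,
    (exists z : 'cV[R]_n, forall i, (A *m z) i 0 <= b i 0) <->
    (forall j, 0 <= (Y *m b) j 0).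
Proof.
elim: n m A => [|n IHn] m A.
  exists m, 1%:M => b; rewrite mul1mx; split=> [[z zP] i | bP].
    by have := zP i; rewrite thinmx0 mul0mx mxE.
  by exists 0 => i; rewrite mulmx0 mxE.
pose a : 'cV[R]_m := lsubmx (A : 'M_(m, 1 + n)).
pose A' : 'M[R]_(m, n) := rsubmx (A : 'M_(m, 1 + n)).
have AE (t : R) (z : 'cV[R]_n) i :
    (A *m col_mx (t%:M : 'cV_1) z) i 0 = a i 0 * t + (A' *m z) i 0.
  rewrite -[A](@hsubmxK _ m 1 n) (@mul_row_col _ m 1 n 1) mul_mx_scalar mxE.
  by congr (_ + _); rewrite mxE mulrC.
have [k [E EP]] := eliminate_variable a.
have [l [Y YP]] := IHn _ (E *m A').
exists l, (Y *m E) => b; rewrite -mulmxA.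
split=> [[z zP] | /YP[z zP]].
  apply/YP; exists (dsubmx (z : 'cV_(1 + n))) => j.
  rewrite -mulmxA -subr_ge0.
  suff : 0 <= (E *m (b - A' *m dsubmx (z : 'cV_(1 + n)))) j 0.
    by rewrite mulmxBr !mxE.
  move: j; apply/EP; exists (usubmx (z : 'cV_(1 + n)) 0 0) => i.
  have := zP i; rewrite -[z](@vsubmxK _ 1 n).
  rewrite [usubmx _]mx11_scalar AE; rewrite col_mxKd -mx11_scalar col_mxKu.
  by move=> le_b; rewrite [leRHS]mxE [X in _ + X]mxE lerBrDr.
have /EP[t tP] : forall j, 0 <= (E *m (b - A' *m z)) j 0.
  move=> j; have := zP j.
  by rewrite -mulmxA -subr_ge0 mulmxBr !mxE.
exists (col_mx (t%:M : 'cV_1) z : 'cV_(1 + n)) => i.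
by rewrite AE -lerBrDr; have := tP i; rewrite [leRHS]mxE [X in _ + X]mxE.
Qed.

End FourierMotzkin.

(** * Affine forms and polyhedral sets *)

Section AffineForms.
Variables (R : realType) (n : nat).
Implicit Types h : 'cV[R]_n -> R.

Definition affine_form h : Prop :=
  exists (a : 'rV[R]_n) (c : R), forall z, h z = (a *m z) 0 0 + c.

Lemma affine_const c : affine_form (fun=> c).
Proof. by exists 0, c => z; rewrite mul0mx mxE add0r. Qed.

Lemma affine_coord i : affine_form (fun z => z i 0).
Proof. by exists (delta_mx 0 i), 0 => z; rewrite -rowE mxE addr0. Qed.

Lemma affineD h1 h2 :
  affine_form h1 -> affine_form h2 -> affine_form (fun z => h1 z + h2 z).
Proof.
move=> [a1 [c1 h1E]] [a2 [c2 h2E]]; exists (a1 + a2), (c1 + c2) => z.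
by rewrite h1E h2E addrACA mulmxDl [in RHS]mxE.
Qed.

Lemma affineZ x h : affine_form h -> affine_form (fun z => x * h z).
Proof.
move=> [a [c hE]]; exists (x *: a), (x * c) => z.
by rewrite hE -scalemxAl [in RHS]mxE mulrDr.
Qed.

Lemma affineN h : affine_form h -> affine_form (fun z => - h z).
Proof.
move=> [a [c hE]]; exists (- a), (- c) => z.
by rewrite hE mulNmx [in RHS]mxE opprD.
Qed.

Lemma affineB h1 h2 :
  affine_form h1 -> affine_form h2 -> affine_form (fun z => h1 z - h2 z).
Proof. by move=> ah1 ah2; apply: affineD => //; exact: affineN. Qed.

Lemma affine_sum I (r : seq I) (F : I -> 'cV[R]_n -> R) :
  (forall i, affine_form (F i)) -> affine_form (fun z => \sum_(i <- r) F i z).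
Proof.
move=> aF; elim: r => [|i r IHr].
  have -> : (fun z => \sum_(i <- [::]) F i z) = (fun=> 0).
    by apply/funext => z; rewrite big_nil.
  exact: affine_const.
have -> : (fun z => \sum_(j <- i :: r) F j z) =
    (fun z => F i z + \sum_(j <- r) F j z).
  by apply/funext => z; rewrite big_cons.
exact: affineD.
Qed.

End AffineForms.

Section PolyhedralSets.
Variable R : realType.

Definition polyhedral n (S : set 'cV[R]_n) : Prop :=
  exists k (A : 'M[R]_(k, n)) (b : 'cV[R]_k),
    S = [set z | forall i, (A *m z) i 0 <= b i 0].

Section Closure.
Variable n : nat.
Implicit Types (S : set 'cV[R]_n) (h : 'cV[R]_n -> R).

Lemma polyhedral_le h1 h2 : affine_form h1 -> affine_form h2 ->
  polyhedral [set z | h1 z <= h2 z].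
Proof.
move=> [a1 [c1 h1E]] [a2 [c2 h2E]]; exists 1, (a1 - a2), (const_mx (c2 - c1)).
apply/seteqP; split=> z /=; rewrite h1E h2E.
  move=> le_h i; rewrite ord1 mulmxBl [leLHS]mxE [X in _ + X]mxE [leRHS]mxE.
  lra.
move=> /(_ 0); rewrite mulmxBl [leLHS]mxE [X in _ + X <= _]mxE [leRHS]mxE.
lra.
Qed.

Lemma polyhedralT : polyhedral [set: 'cV[R]_n].
Proof. by exists 0, 0, 0; apply/seteqP; split=> // z _ []. Qed.

Lemma polyhedralI S1 S2 :
  polyhedral S1 -> polyhedral S2 -> polyhedral (S1 `&` S2).
Proof.
move=> [k1 [A1 [b1 ->]]] [k2 [A2 [b2 ->]]].
exists (k1 + k2)%N, (col_mx A1 A2), (col_mx b1 b2).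
apply/seteqP; split=> z /=; rewrite mul_col_mx.
  move=> [le1 le2] i; case: (split_ordP i) => j ->.
    by rewrite !col_mxEu.
  by rewrite !col_mxEd.
move=> le12; split=> i.
  by have := le12 (lshift k2 i); rewrite !col_mxEu.
by have := le12 (rshift k1 i); rewrite !col_mxEd.
Qed.

Lemma polyhedral_forall_in (T : eqType) (s : seq T) (S : T -> set 'cV[R]_n) :
  (forall t, polyhedral (S t)) ->
  polyhedral [set z | forall t, t \in s -> S t z].
Proof.
move=> pS; elim: s => [|t s IHs].
  rewrite (_ : [set z | _] = setT); first exact: polyhedralT.
  by apply/seteqP; split.
have := polyhedralI (pS t) IHs; congr polyhedral.
apply/seteqP; split=> z /= => [[Stz Ssz] u | Sz].
  by rewrite inE => /predU1P[->//|]; exact: Ssz.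
by split=> [|u us]; apply: Sz; rewrite inE ?eqxx ?us ?orbT.
Qed.

Lemma polyhedral_forall (T : finType) (S : T -> set 'cV[R]_n) :
  (forall t, polyhedral (S t)) -> polyhedral [set z | forall t, S t z].
Proof.
move=> pS; have := polyhedral_forall_in (enum T) pS; congr polyhedral.
by apply/seteqP; split=> z /= Sz t => [|_]; apply: Sz; rewrite mem_enum.
Qed.

Lemma polyhedral_eq h1 h2 : affine_form h1 -> affine_form h2 ->
  polyhedral [set z | h1 z = h2 z].
Proof.
move=> a1 a2.
have := polyhedralI (polyhedral_le a1 a2) (polyhedral_le a2 a1).
congr polyhedral; apply/seteqP; split=> z /= => [[le12 le21] | ->//].
by apply/le_anti; rewrite le12.
Qed.

Lemma polyhedral_between h1 h2 h3 :
  affine_form h1 -> affine_form h2 -> affine_form h3 ->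
  polyhedral [set z | h1 z <= h2 z <= h3 z].
Proof.
move=> a1 a2 a3.
have := polyhedralI (polyhedral_le a1 a2) (polyhedral_le a2 a3).
by congr polyhedral; apply/seteqP; split=> z /= /andP.
Qed.

Lemma polyhedral_norm_le h c :
  affine_form h -> polyhedral [set z | `|h z| <= c].
Proof.
move=> ah.
have := polyhedral_between (affine_const _ (- c)) ah (affine_const _ c).
by congr polyhedral; apply/seteqP; split=> z /=; rewrite ler_norml.
Qed.

End Closure.

(** For a fixed w the constraints on z have the right-hand side b - A_w w, and the
solvability conditions of [fourier_motzkin] are affine in it, hence in w. *)
Lemma polyhedral_projection n m (S : set 'cV[R]_(n + m)) :
  polyhedral S -> polyhedral [set w : 'cV[R]_m | exists z, S (col_mx z w)].
Proof.
move=> [k [A [b ->]]].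
have [l [Y YP]] := fourier_motzkin (lsubmx A).
exists l, (Y *m rsubmx A), (Y *m b); apply/seteqP; split=> w /=.
  move=> [z zP] j; rewrite -mulmxA -subr_ge0.
  suff /(_ j) : forall j, 0 <= (Y *m (b - rsubmx A *m w)) j 0.
    by rewrite mulmxBr !mxE.
  apply/YP; exists z => i; have := zP i.
  by rewrite -{1}[A]hsubmxK mul_row_col !mxE lerBrDr.
move=> wP; have /YP[z zP] : forall j, 0 <= (Y *m (b - rsubmx A *m w)) j 0.
  by move=> j; have := wP j; rewrite -mulmxA -subr_ge0 mulmxBr !mxE.
exists z => i; rewrite -[A]hsubmxK mul_row_col.
by have := zP i; rewrite !mxE lerBrDr.
Qed.

End PolyhedralSets.

(** * Functions with a polyhedral epigraph *)

(** The set is closed because it is given by finitely many weak inequalities: its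
minimum is the largest of the lower bounds [d i / c i] with [c i < 0].  Without
such a bound the set would be closed under decrease. *)
Lemma half_line_minimum (R : realType) k (c d : 'I_k -> R) (B : R) :
  let V := [set v | forall i, c i * v <= d i] in
  V !=set0 -> lbound V B -> exists2 v, V v & lbound V v.
Proof.
move=> V [v0 Vv0] lbB.
case: (pickP (fun i => c i < 0)) => [i0 ci0 | nneg]; last first.
  have /lbB : V (Num.min v0 (B - 1)).
    move=> i; apply: le_trans (Vv0 i); apply: ler_wpM2l.
      by rewrite leNgt nneg.
    by rewrite ge_min lexx.
  by rewrite le_min => /andP[_]; lra.
pose i := [arg max_(i > i0 | c i < 0) (d i / c i)]%O.
have [ci imax] : c i < 0 /\ forall j, c j < 0 -> d j / c j <= d i / c i.
  by rewrite /i; case: arg_maxP.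
exists (d i / c i) => [j | v /(_ i)]; last by rewrite mulrC -ler_ndivrMr.
case: (ltP (c j) 0) => cj; first by rewrite mulrC -ler_ndivrMr// imax.
apply: le_trans (Vv0 j); apply: ler_wpM2l => //.
by rewrite ler_ndivrMr// mulrC; exact: Vv0.
Qed.

Section PolyhedralEpigraph.
Variables (R : realType) (D : set (plane R)) (f : plane R -> R).
Variables (k : nat) (a b c d : 'I_k -> R).
Hypothesis epigraphP : forall (p : plane R) v,
  D p /\ f p <= v <-> forall i, a i * p.1 + b i * p.2 + c i * v <= d i.

(** For [c i < 0], the lower bound that the i-th inequality imposes on v. *)
Let piece i (p : plane R) : R := (d i - a i * p.1 - b i * p.2) / c i.

Let piece_le i p v : c i < 0 ->
  (piece i p <= v) = (a i * p.1 + b i * p.2 + c i * v <= d i).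
Proof.
move=> ci; rewrite /piece ler_ndivrMr// [v * _]mulrC.
by apply/idP/idP => h; lra.
Qed.

Let piece_lef i p : D p -> c i < 0 -> piece i p <= f p.
Proof. by move=> Dp ci; rewrite piece_le//; apply: (epigraphP p (f p)).1. Qed.

(** On the domain f is the maximum of its pieces: a number below f p but above all
the pieces would satisfy every inequality, and so be the ordinate of a point of
the epigraph lying below the graph. *)
Let active p : D p -> exists2 i, c i < 0 & f p = piece i p.
Proof.
move=> Dp.
have vP : [set v | forall i, c i * v <= d i - a i * p.1 - b i * p.2]
    = [set v | f p <= v].
  apply/seteqP; split=> v /=.
    by move=> vP; apply: ((epigraphP p v).2 _).2 => i; have := vP i; lra.
  by move=> le_fv i; have := (epigraphP p v).1 (conj Dp le_fv) i; lra.
apply: contrapT => noti.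
(* f p - 1 only serves as a default, below f p, when there is no piece *)
pose m := \big[Order.max/(f p - 1)]_(i | c i < 0) piece i p.
have lt_m : m < f p.
  rewrite /m; elim/big_ind: _ => [|x y xf yf|i ci]; first lra.
    by rewrite gt_max xf.
  rewrite lt_neqAle piece_lef// andbT; apply/eqP => eq_f.
  by apply: noti; exists i.
have : [set v | f p <= v] m.
  rewrite -vP => i; case: (ltP (c i) 0) => ci.
    have : piece i p <= m by rewrite /m; exact: le_bigmax_cond.
    by rewrite piece_le//; lra.
  have : [set v | f p <= v] (f p) by exact: lexx.
  rewrite -vP => /(_ i); apply: le_trans; apply: ler_wpM2l => //.
  exact: ltW.
by rewrite /= leNgt lt_m.
Qed.

Let pieceE i : exists x y z : R, forall p, piece i p = x * p.1 + y * p.2 + z.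
Proof.
exists (- (a i / c i)), (- (b i / c i)), (d i / c i) => p.
by rewrite /piece; ring.
Qed.

(** The region where f p <= piece i p is a section of the epigraph by the graph of
an affine function, so the inequalities of the epigraph, in which that function
replaces v, describe it as a polyhedron. *)
Lemma epigraph_piecewise_linear : piecewise_linear_on D f.
Proof.
pose P i := [set p | c i < 0 /\ (D p /\ f p <= piece i p)].
exists k, P; split.
  apply/seteqP; split=> [p Dp | p [i _ [_ []]]//].
  by have [i ci fE] := active Dp; exists i => //; rewrite /P /= -fE.
move=> i; split; last first.
  have [x [y [z sE]]] := pieceE i; exists x, y, z => p [ci [Dp le_f]].
  by rewrite -sE; apply/le_anti; rewrite le_f piece_lef.
case: (ltP (c i) 0) => ci; last first.
  (* the i-th inequality gives no piece: an empty polyhedron takes its place *)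
  exists 1, (fun=> 0), (fun=> 0), (fun=> -1).
  apply/seteqP; split=> p /=; first by case; rewrite ltNge ci.
  by move=> /(_ 0); lra.
have [x [y [z sE]]] := pieceE i.
exists k, (fun j => a j + c j * x), (fun j => b j + c j * y),
  (fun j => d j - c j * z).
apply/seteqP; split=> p /=.
  by move=> [_ /epigraphP h j]; have := h j; rewrite sE; lra.
move=> h; split=> //; apply/epigraphP => j.
by have := h j; rewrite sE; lra.
Qed.

Lemma epigraph_convex : convex_on D f.
Proof.
have conv_epi (t : R) (p q : plane R) : 0 <= t <= 1 -> D p -> D q ->
    D (t *: p + (1 - t) *: q) /\
    f (t *: p + (1 - t) *: q) <= t * f p + (1 - t) * f q.
  move=> /andP[t0 t1] Dp Dq; apply/epigraphP => i /=.
  have := (epigraphP p (f p)).1 (conj Dp (lexx _)) i.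
  have := (epigraphP q (f q)).1 (conj Dq (lexx _)) i.
  have s0 : 0 <= 1 - t by lra.
  move=> /(ler_wpM2l s0) qi /(ler_wpM2l t0) pi.
  rewrite /GRing.scale /=; lra.
split=> [p q t /set_mem Dp /set_mem Dq | t p q /set_mem Dp /set_mem Dq].
  by apply/mem_set; apply: (conv_epi _ _ _ _ Dp Dq).1; rewrite ge0 le1.
by apply: (conv_epi _ _ _ _ Dp Dq).2; rewrite ge0 le1.
Qed.

(** If i is active at p and j at q, then f p - f q lies between the increments
from q to p of the pieces j and i; finitely many pieces are all close at once. *)
Lemma epigraph_continuous : {within D, continuous f}.
Proof.
have piece_cvg i (p : plane R) : piece i q @[q --> p] --> piece i p.
  apply: cvgM; last exact: cvg_cst.
  by apply: cvgB; [apply: cvgB; [exact: cvg_cst|]|]; apply: cvgM;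
    [exact: cvg_cst | exact: cvg_fst | exact: cvg_cst | exact: cvg_snd].
apply/subspace_continuousP => p Dp; apply/cvgrPdist_lt => e e0.
rewrite near_withinE.
have : \forall q \near p, forall i, `|piece i p - piece i q| < e.
  apply: (@filter_forall _ _ _ (nbhs p)).
  move=> i; move/cvgrPdist_lt : (piece_cvg i p).
  exact.
apply: filterS => q close_q Dq.
have [i ci fp] := active Dp; have [j cj fq] := active Dq.
have := piece_lef Dp cj; have := piece_lef Dq ci.
rewrite fp fq => le_q le_p; rewrite /from_subspace fp fq ltr_norml.
have := close_q i; have := close_q j.
rewrite !ltr_norml => /andP[? ?] /andP[? ?].
by apply/andP; split; lra.
Qed.

End PolyhedralEpigraph.

(** * Value functions of parametric linear programs *)

Section ParametricPrograms.
Variables (R : realType) (X : Type).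
Implicit Types (feas : plane R -> set X) (obj : X -> R).

(** The pairs (p, v) on the left form the epigraph of the value function, provided
that minima are attained; stated with an existential, the condition needs no
such proviso and is what the elimination of x delivers. *)
Definition polyhedral_program feas obj : Prop :=
  exists (k : nat) (a b c d : 'I_k -> R), forall (p : plane R) v,
    (exists2 x, feas p x & obj x <= v) <->
    (forall i, a i * p.1 + b i * p.2 + c i * v <= d i).

Lemma minimum_attained feas obj B p :
  polyhedral_program feas obj -> (forall x, feas p x -> B <= obj x) ->
  feas p !=set0 ->
  exists2 x, feas p x & obj x = minimum (obj @` feas p) /\
    forall y, feas p y -> obj x <= obj y.
Proof.
move=> [k [a [b [c [d epiP]]]]] lbB [x0 feas_x0].
pose d' i := d i - a i * p.1 - b i * p.2.
have d'P v : (forall i, c i * v <= d' i) <-> exists2 x, feas p x & obj x <= v.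
  rewrite epiP /d'; split=> h i; have := h i; lra.
have [||v /d'P[x feas_x le_v] v_min] := @half_line_minimum R k c d' B.
- by exists (obj x0); apply/d'P; exists x0.
- by move=> v /d'P[x /lbB]; exact: le_trans.
have x_min y : feas p y -> obj x <= obj y.
  by move=> feas_y; apply: le_trans le_v _; apply/v_min/d'P; exists y.
exists x => //; split=> //; symmetry; apply: minimumE; first by exists x.
by move=> _ [y feas_y <-]; exact: x_min.
Qed.

Lemma minimum_le feas obj B p q :
  polyhedral_program feas obj -> (forall p x, feas p x -> B <= obj x) ->
  feas q !=set0 ->
  (forall x, feas q x -> exists2 y, feas p y & obj y <= obj x) ->
  minimum (obj @` feas p) <= minimum (obj @` feas q).
Proof.
move=> prog lbB ne_q improve.
have [x feas_x [<- _]] := minimum_attained prog (lbB q) ne_q.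
have [y feas_y le_yx] := improve x feas_x.
have [|z _ [<- z_min]] := minimum_attained (p := p) prog (lbB p).
  by exists y.
by apply: le_trans le_yx; exact: z_min.
Qed.

Lemma minimal_value_regular feas obj (D := [set p | feas p !=set0])
    (f := fun p => minimum (obj @` feas p)) B :
  polyhedral_program feas obj -> (forall p x, feas p x -> B <= obj x) ->
  [/\ {within D, continuous f}, piecewise_linear_on D f & convex_on D f].
Proof.
move=> prog lbB; have [k [a [b [c [d epiP]]]]] := prog.
have epigraphP p v :
    D p /\ f p <= v <-> forall i, a i * p.1 + b i * p.2 + c i * v <= d i.
  rewrite -epiP; split=> [[Dp le_v] | [x feas_x le_v]].
    have [x feas_x [xE _]] := minimum_attained prog (lbB p) Dp.
    by exists x => //; rewrite xE.
  have Dp : D p by exists x.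
  have [y feas_y [yE y_min]] := minimum_attained prog (lbB p) Dp.
  by split=> //; rewrite /f -yE; apply: le_trans le_v; exact: y_min.
split; [exact: epigraph_continuous epigraphP
  | exact: epigraph_piecewise_linear epigraphP
  | exact: epigraph_convex epigraphP].
Qed.

(** This holds for every A: if no maximum exists, both sides take the default
value 0. *)
Lemma maximumN (A : set R) : maximum A = - minimum (-%R @` A).
Proof.
have minN v : A v -> ubound A v -> minimum (-%R @` A) = - v.
  move=> Av ub_v; apply: minimumE; first by exists v.
  by move=> _ [w Aw <-]; rewrite lerN2; exact: ub_v.
have [[v [Av ub_v]] | nomax] := pselect (A `&` ubound A !=set0).
  by rewrite (maximumE Av ub_v) (minN _ Av ub_v) opprK.
rewrite /maximum /minimum !xgetPN ?oppr0// => v; last first.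
  by move=> ?; apply: nomax; exists v.
move=> [[w Aw <-] lb_w]; apply: nomax; exists w; split=> // u Au.
by rewrite -lerN2; apply: lb_w; exists u.
Qed.

Lemma maximal_value_regular feas obj (D := [set p | feas p !=set0])
    (f := fun p => maximum (obj @` feas p)) B :
  polyhedral_program feas (fun x => - obj x) ->
  (forall p x, feas p x -> obj x <= B) ->
  [/\ {within D, continuous f}, piecewise_linear_on D f & concave_on D f].
Proof.
move=> prog ubB.
pose g p := minimum ((fun x => - obj x) @` feas p).
have fE : f = (fun p => - g p).
  by apply/funext => p; rewrite /f maximumN image_comp.
have [|contg [k [P [DE PP]]] convg] := @minimal_value_regular _ _ (- B) prog.
  by move=> p x /ubB; rewrite lerN2.
split.
- rewrite fE; apply/subspace_continuousP => p Dp.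
  by apply: cvgN; move/subspace_continuousP : contg; exact.
- exists k, P; split=> // i; have [polyP [x [y [z gE]]]] := PP i.
  split=> //; exists (- x), (- y), (- z) => p Pp.
  by rewrite fE /g gE//; lra.
- rewrite /concave_on fE.
  by rewrite (_ : (fun p => - - g p) = g)//; apply/funext => p; rewrite opprK.
Qed.

Lemma maximum_le feas obj B p q :
  polyhedral_program feas (fun x => - obj x) ->
  (forall p x, feas p x -> obj x <= B) -> feas q !=set0 ->
  (forall x, feas q x -> exists2 y, feas p y & obj x <= obj y) ->
  maximum (obj @` feas q) <= maximum (obj @` feas p).
Proof.
move=> prog ubB ne_q improve; rewrite !maximumN !image_comp lerN2.
apply: (@minimum_le _ (fun x => - obj x) (- B)) prog _ ne_q _.
  by move=> r x /ubB; rewrite lerN2.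
by move=> x /improve[y feas_y le_xy]; exists y; rewrite ?lerN2.
Qed.

End ParametricPrograms.

(** * The dispatch problems as polyhedral programs *)

Section Coordinates.
Variables (R : realType) (N L D : nat) (I : network R N L D).

Local Notation dim := (N + N + (N + N))%N.

(** Elimination works on column vectors, so a dispatch is read off the four blocks
of a column. *)
Definition dispatch_of_col (z : 'cV[R]_dim) : dispatch R N :=
  Dispatch (usubmx (usubmx z)) (dsubmx (usubmx z))
           (usubmx (dsubmx z)) (dsubmx (dsubmx z)).

Lemma dispatch_of_col_surj x : exists z, dispatch_of_col z = x.
Proof.
case: x => g0 g1 u d; exists (col_mx (col_mx g0 g1) (col_mx u d)).
by rewrite /dispatch_of_col !(col_mxKu, col_mxKd).
Qed.

Definition dispatch_part (y : 'cV[R]_(dim + 3)) : dispatch R N :=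
  dispatch_of_col (usubmx y).

(** The three coordinates below the dispatch hold the two arguments of a value
function and the bound v on the objective. *)
Definition param (j : 'I_3) (y : 'cV[R]_(dim + 3)) : R := y (rshift dim j) 0.

Local Notation x_ := dispatch_part.

Lemma affine_param j : affine_form (param j).
Proof. exact: affine_coord. Qed.

Lemma affine_gen t n : affine_form (fun y => gen I (x_ y) t n 0).
Proof.
rewrite /gen; case: (t == -1); first exact: affine_const.
case: (t == 0).
  have := affine_coord R (lshift 3 (lshift (N + N) (lshift N n))).
  by congr affine_form; apply/funext => y; rewrite !mxE.
have := affine_coord R (lshift 3 (lshift (N + N) (rshift N n))).
by congr affine_form; apply/funext => y; rewrite !mxE.
Qed.

Lemma affine_rup t n : affine_form (fun y => rup (x_ y) t n 0).
Proof.
rewrite /rup; case: (t == 1).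
  have := affine_coord R (lshift 3 (rshift (N + N) (lshift N n))).
  by congr affine_form; apply/funext => y; rewrite !mxE.
have := affine_const (dim + 3) (0 : R).
by congr affine_form; apply/funext => y; rewrite mxE.
Qed.

Lemma affine_rdown t n : affine_form (fun y => rdown (x_ y) t n 0).
Proof.
rewrite /rdown; case: (t == 1).
  have := affine_coord R (lshift 3 (rshift (N + N) (rshift N n))).
  by congr affine_form; apply/funext => y; rewrite !mxE.
have := affine_const (dim + 3) (0 : R).
by congr affine_form; apply/funext => y; rewrite mxE.
Qed.

Lemma affine_cost : affine_form (fun y => cost I (x_ y)).
Proof.
by apply: affine_sum => t; apply: affine_sum => n; apply/affineZ/affine_gen.
Qed.

Lemma affine_total_up : affine_form (fun y => total_up (x_ y)).
Proof. by apply: affine_sum => n; exact: affine_rup. Qed.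

Lemma affine_total_down : affine_form (fun y => total_down (x_ y)).
Proof. by apply: affine_sum => n; exact: affine_rdown. Qed.

Lemma polyhedral_line t : polyhedral [set y | line_constraints I (x_ y) t].
Proof.
apply: polyhedral_forall => l.
apply: polyhedral_between; [exact: affine_const| |exact: affine_const].
have /affineB/(_ (affine_const _ ((Hd I *m demand I t) l 0))) :=
  affine_sum (index_enum 'I_N) (fun n => affineZ (Hg I l n) (affine_gen t n)).
congr affine_form; apply/funext => y.
by rewrite [in RHS]mxE [X in _ = X + _]mxE [X in _ = _ + X]mxE.
Qed.

Lemma polyhedral_balance t :
  polyhedral [set y | balance_constraint I (x_ y) t].
Proof.
apply: polyhedral_eq; last exact: affine_const.
by apply: affineB; [apply: affine_sum => n; exact: affine_gen
  | exact: affine_const].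
Qed.

Lemma polyhedral_capacity t :
  polyhedral [set y | capacity_constraints I (x_ y) t].
Proof.
apply: polyhedral_forall => n; apply: polyhedralI;
  apply: polyhedral_between; try exact: affine_const.
  by apply: affineD; [exact: affine_gen | exact: affine_rup].
by apply: affineB; [exact: affine_gen | exact: affine_rdown].
Qed.

Lemma polyhedral_ramping t :
  polyhedral [set y | ramping_constraints I (x_ y) t].
Proof.
apply: polyhedral_forall => n.
have step := affineB (affine_gen (t + 1) n) (affine_gen t n).
apply: polyhedralI; apply: polyhedral_norm_le.
  exact: affineD (affineD step (affine_rup _ n)) (affine_rdown t n).
exact: affineB (affineB step (affine_rdown _ n)) (affine_rup t n).
Qed.

Lemma polyhedral_sign : polyhedral [set y | sign_constraints I (x_ y)].
Proof.
apply: polyhedral_forall => n.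
have ge0 h : affine_form h ->
    polyhedral [set y : 'cV[R]_(dim + 3) | 0 <= h y].
  by move=> ah; apply: polyhedral_le => //; exact: affine_const.
have := polyhedralI
  (polyhedralI (ge0 _ (affine_gen 0 n)) (ge0 _ (affine_gen 1 n)))
  (polyhedralI (ge0 _ (affine_rup 1 n)) (ge0 _ (affine_rdown 1 n))).
by congr polyhedral; apply/seteqP; split=> y /= => [[[? ?] [? ?]] | []].
Qed.

Lemma polyhedral_base : polyhedral [set y | base_constraints I (x_ y)].
Proof.
have := polyhedralI (polyhedralI (polyhedralI
    (polyhedral_forall_in [:: 0; 1] polyhedral_line)
    (polyhedral_forall_in [:: 0; 1] polyhedral_balance))
  (polyhedralI (polyhedral_forall_in [:: 0; 1] polyhedral_capacity)
    (polyhedral_forall_in [:: -1; 0] polyhedral_ramping))) polyhedral_sign.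
congr polyhedral.
by apply/seteqP; split=> y /= => [[[[? ?] [? ?]] ?] | []].
Qed.

(** Projecting out the coordinates of the dispatch amounts to quantifying over all
dispatches, by [dispatch_of_col_surj]. *)
Lemma polyhedral_programI (feas : plane R -> set (dispatch R N))
    (obj : dispatch R N -> R) :
  polyhedral [set y | feas (param 0 y, param 1 y) (x_ y) /\
                      obj (x_ y) <= param 2 y] ->
  polyhedral_program feas obj.
Proof.
move/polyhedral_projection => [k [A [b AP]]].
exists k, (A^~ 0), (A^~ 1), (A^~ 2), (b^~ 0).
move=> p v; pose w : 'cV[R]_3 := \col_j [:: p.1; p.2; v]`_j.
have wE (z : 'cV[R]_dim) j : param j (col_mx z w) = [:: p.1; p.2; v]`_j.
  by rewrite /param col_mxEd mxE.
have := congr1 (fun S => S w) AP; rewrite /= => {}AP.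
have AwE i : (A *m w) i 0 = A i 0 * p.1 + A i 1 * p.2 + A i 2 * v.
  rewrite mxE !big_ord_recl big_ord0 addr0 !mxE /= addrA.
  by congr (_ * _ + _ * _ + _ * _); congr (A i _); apply/val_inj.
have -> : (exists2 x, feas p x & obj x <= v) <->
    (forall i, (A *m w) i 0 <= b i 0).
  rewrite -AP; split=> [[x feas_x le_v] | [z]].
    have [z zE] := dispatch_of_col_surj x; exists z.
    by rewrite /dispatch_part !wE col_mxKu zE -surjective_pairing.
  rewrite /dispatch_part !wE col_mxKu /= -surjective_pairing => -[feas_z le_v].
  by exists (dispatch_of_col z).
by split=> h i; have := h i; rewrite AwE.
Qed.

Lemma MinC_program : polyhedral_program (MinC_feasible I) (cost I).
Proof.
apply: polyhedral_programI.
have := polyhedralI (polyhedralI polyhedral_base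
  (polyhedral_le affine_cost (affine_param 2)))
  (polyhedralI (polyhedral_eq affine_total_up (affine_param 0))
               (polyhedral_eq affine_total_down (affine_param 1))).
by congr polyhedral; apply/seteqP;
  split=> y /= => [[[? ?] [? ?]] | [[? ? ?] ?]].
Qed.

Lemma MaxUR_program :
  polyhedral_program (MaxUR_feasible I) (fun x => - total_up x).
Proof.
apply: polyhedral_programI.
have := polyhedralI (polyhedralI polyhedral_base
  (polyhedral_le (affineN affine_total_up) (affine_param 2)))
  (polyhedralI (polyhedral_le affine_cost (affine_param 0))
               (polyhedral_eq affine_total_down (affine_param 1))).
by congr polyhedral; apply/seteqP;
  split=> y /= => [[[? ?] [? ?]] | [[? ? ?] ?]].
Qed.

Lemma MaxDR_program :
  polyhedral_program (MaxDR_feasible I) (fun x => - total_down x).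
Proof.
apply: polyhedral_programI.
have := polyhedralI (polyhedralI polyhedral_base
  (polyhedral_le (affineN affine_total_down) (affine_param 2)))
  (polyhedralI (polyhedral_le affine_cost (affine_param 0))
               (polyhedral_eq affine_total_up (affine_param 1))).
by congr polyhedral; apply/seteqP;
  split=> y /= => [[[? ?] [? ?]] | [[? ? ?] ?]].
Qed.

End Coordinates.

(** * Bounds on dispatches and reduction of reserves *)

Section Reserves.
Variables (R : realType) (N L D : nat) (I : network R N L D).
Implicit Types x : dispatch R N.

Lemma base_rup_ge0 x t n : base_constraints I x -> 0 <= rup x t n 0.
Proof.
case=> _ _ _ _ /(_ n)[_ _ u0 _].
by rewrite /rup; case: eqP u0; rewrite ?mxE.
Qed.

Lemma base_rdown_ge0 x t n : base_constraints I x -> 0 <= rdown x t n 0.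
Proof.
case=> _ _ _ _ /(_ n)[_ _ _ d0].
by rewrite /rdown; case: eqP d0; rewrite ?mxE.
Qed.

Lemma base_gen_itv x t n : base_constraints I x -> t \in [:: 0; 1] ->
  0 <= gen I x t n 0 <= gmax I n 0.
Proof.
move=> base_x t01; have u0 := base_rup_ge0 t n base_x.
case: base_x => _ _ /(_ _ t01 n)[/andP[_ le_max] _] _ /(_ n)[g0 g1 _ _].
apply/andP; split; last lra.
by move: t01; rewrite !inE => /orP[] /eqP ->.
Qed.

Lemma total_up_le x :
  base_constraints I x -> total_up x <= \sum_n gmax I n 0.
Proof.
move=> base_x; apply: ler_sum => n _.
have /andP[g0 _] := base_gen_itv n base_x (mem_last 0 [:: 1]).
case: base_x => _ _ /(_ 1 (mem_last 0 [:: 1]) n)[/andP[_ le_max] _] _ _; lra.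
Qed.

Lemma total_down_le x :
  base_constraints I x -> total_down x <= \sum_n (gmax I n 0 - gmin I n 0).
Proof.
move=> base_x; apply: ler_sum => n _.
have /andP[_ g1] := base_gen_itv n base_x (mem_last 0 [:: 1]).
case: base_x => _ _ /(_ 1 (mem_last 0 [:: 1]) n)[_ /andP[ge_min _]] _ _; lra.
Qed.

Lemma cost_ge x : base_constraints I x ->
  \sum_(t <- [:: 0; 1 : int]) \sum_n - (`|bid I n 0| * gmax I n 0) <= cost I x.
Proof.
move=> base_x; rewrite /cost big_seq [leRHS]big_seq.
apply: ler_sum => t t01; apply: ler_sum => n _.
have /andP[g0 g1] := base_gen_itv n base_x t01.
apply: le_trans (_ : - `|bid I n 0 * gen I x t n 0| <= _).
  by rewrite lerN2 normrM (ger0_norm g0) ler_wpM2l.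
by rewrite lerNl; apply: le_trans (ler_norm _) _; rewrite normrN.
Qed.

Definition shrink_reserves (l m : R) x : dispatch R N :=
  Dispatch (gen0 x) (gen1 x) (l *: rup1 x) (m *: rdown1 x).

Lemma rup_shrink l m x t n :
  rup (shrink_reserves l m x) t n 0 = l * rup x t n 0.
Proof. by rewrite /rup; case: (t == 1); rewrite !mxE ?mulr0. Qed.

Lemma rdown_shrink l m x t n :
  rdown (shrink_reserves l m x) t n 0 = m * rdown x t n 0.
Proof. by rewrite /rdown; case: (t == 1); rewrite !mxE ?mulr0. Qed.

Lemma total_up_shrink l m x :
  total_up (shrink_reserves l m x) = l * total_up x.
Proof. by rewrite mulr_sumr; apply: eq_bigr => n _; rewrite rup_shrink. Qed.

Lemma total_down_shrink l m x :
  total_down (shrink_reserves l m x) = m * total_down x.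
Proof. by rewrite mulr_sumr; apply: eq_bigr => n _; rewrite rdown_shrink. Qed.

(** The capacity and ramping constraints come in pairs: an expression to which
reserves are added and one from which reserves are subtracted, with the same
bounds.  Smaller reserves relax the upper bound on the former and the lower bound
on the latter.  The two opposite bounds follow from the other member of the pair,
because reserves are nonnegative: gmin <= g - r^d <= g <= g + l r^u, for
instance. *)
Lemma shrink_reserves_base l m x : 0 <= l <= 1 -> 0 <= m <= 1 ->
  base_constraints I x -> base_constraints I (shrink_reserves l m x).
Proof.
move=> /andP[l0 l1] /andP[m0 m1] base_x.
have genE t n : gen I (shrink_reserves l m x) t n 0 = gen I x t n 0 by [].
have lu t n : 0 <= l * rup x t n 0 <= rup x t n 0.
  by rewrite mulr_ge0 ?ler_piMl// (base_rup_ge0 _ _ base_x).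
have md t n : 0 <= m * rdown x t n 0 <= rdown x t n 0.
  by rewrite mulr_ge0 ?ler_piMl// (base_rdown_ge0 _ _ base_x).
case: (base_x) => line balance capacity ramping sign.
split=> // [t /capacity cap n | t /ramping ramp n | n].
- rewrite !genE rup_shrink rdown_shrink.
  have [/andP[? ?] /andP[? ?]] := cap n.
  have /andP[? ?] := lu t n; have /andP[? ?] := md t n.
  by split; apply/andP; split; lra.
- rewrite !genE !rup_shrink !rdown_shrink.
  have [] := ramp n; rewrite !ler_norml => /andP[? ?] /andP[? ?].
  have /andP[? ?] := lu t n; have /andP[? ?] := md t n.
  have /andP[? ?] := lu (t + 1) n; have /andP[? ?] := md (t + 1) n.
  by split; apply/andP; split; lra.
- have [? ? ? ?] := sign n; split=> //.
    by rewrite rup_shrink mulr_ge0.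
  by rewrite rdown_shrink mulr_ge0.
Qed.

End Reserves.

(** * The three value functions *)

Section ValueFunctions.
Variables (R : realType) (N L D : nat) (I : network R N L D).

(** Nonnegativity of the requirements is implied by feasibility, as sums of
nonnegative capacities; likewise for the two other domains. *)
Lemma MinC_domE : MinC_dom I = [set p | MinC_feasible I p !=set0].
Proof.
apply/seteqP; split=> p /=; first by case.
move=> feas_p; case: (feas_p) => x [base_x up down].
by split=> //; [rewrite -up | rewrite -down]; apply: sumr_ge0 => n _;
  [exact: base_rup_ge0 base_x | exact: base_rdown_ge0 base_x].
Qed.

Lemma MaxUR_domE : MaxUR_dom I = [set p | MaxUR_feasible I p !=set0].
Proof.
apply/seteqP; split=> p /=; first by case.
move=> feas_p; case: (feas_p) => x [base_x _ down]; split=> //.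
by rewrite -down; apply: sumr_ge0 => n _; exact: base_rdown_ge0 base_x.
Qed.

Lemma MaxDR_domE : MaxDR_dom I = [set p | MaxDR_feasible I p !=set0].
Proof.
apply/seteqP; split=> p /=; first by case.
move=> feas_p; case: (feas_p) => x [base_x _ up]; split=> //.
by rewrite -up; apply: sumr_ge0 => n _; exact: base_rup_ge0 base_x.
Qed.

Lemma scaling_factor (r s : R) :
  0 <= r -> r <= s -> exists2 l, 0 <= l <= 1 & l * s = r.
Proof.
move=> r0 le_rs; have s0 := le_trans r0 le_rs.
have [s_eq0 | s_neq0] := eqVneq s 0.
  exists 0; first by rewrite lexx ler01.
  by rewrite mul0r; apply/le_anti; rewrite r0 -s_eq0 le_rs.
have s_gt0 : 0 < s by rewrite lt_neqAle eq_sym s_neq0.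
by exists (r / s); rewrite ?divfK// divr_ge0// ler_pdivrMr// mul1r.
Qed.

Lemma reduce_up x (r : R) : base_constraints I x -> 0 <= r <= total_up x ->
  exists2 y, base_constraints I y &
    [/\ cost I y = cost I x, total_up y = r & total_down y = total_down x].
Proof.
move=> base_x /andP[r0 le_r]; have [l l01 <-] := scaling_factor r0 le_r.
exists (shrink_reserves l 1 x).
  by apply: shrink_reserves_base => //; rewrite ler01 lexx.
by split=> //; rewrite ?total_up_shrink// total_down_shrink mul1r.
Qed.

Lemma reduce_down x (r : R) : base_constraints I x -> 0 <= r <= total_down x ->
  exists2 y, base_constraints I y &
    [/\ cost I y = cost I x, total_up y = total_up x & total_down y = r].
Proof.
move=> base_x /andP[r0 le_r]; have [l l01 <-] := scaling_factor r0 le_r.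
exists (shrink_reserves 1 l x).
  by apply: shrink_reserves_base => //; rewrite ler01 lexx.
by split=> //; rewrite ?total_down_shrink// total_up_shrink mul1r.
Qed.

Lemma MinC_nondecreasing_up : nondecreasing_arg1 (MinC_dom I) (MinC I).
Proof.
move=> u u' d [u0 _ _] [_ _ ne] le_u.
apply: minimum_le (MinC_program I) _ ne _ => [p x [base_x _ _]|].
  exact: cost_ge base_x.
move=> x [base_x upE downE].
have [|y base_y [costE yup ydown]] := @reduce_up x u base_x.
  by rewrite u0 upE.
by exists y; [split=> //; rewrite ydown | rewrite costE].
Qed.

Lemma MinC_nondecreasing_down : nondecreasing_arg2 (MinC_dom I) (MinC I).
Proof.
move=> u d d' [_ d0 _] [_ _ ne] le_d.
apply: minimum_le (MinC_program I) _ ne _ => [p x [base_x _ _]|].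
  exact: cost_ge base_x.
move=> x [base_x upE downE].
have [|y base_y [costE yup ydown]] := @reduce_down x d base_x.
  by rewrite d0 downE.
by exists y; [split=> //; rewrite yup | rewrite costE].
Qed.

Lemma MaxUR_nondecreasing_budget : nondecreasing_arg1 (MaxUR_dom I) (MaxUR I).
Proof.
move=> th th' d [_ ne] _ le_th.
apply: maximum_le (MaxUR_program I) _ ne _ => [p x [base_x _ _]|].
  exact: total_up_le base_x.
by move=> x [base_x le_cost down]; exists x => //; split=> //;
  exact: le_trans le_th.
Qed.

Lemma MaxUR_nonincreasing_down : nonincreasing_arg2 (MaxUR_dom I) (MaxUR I).
Proof.
move=> th d d' [d0 _] [_ ne] le_d.
apply: maximum_le (MaxUR_program I) _ ne _ => [p x [base_x _ _]|].
  exact: total_up_le base_x.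
move=> x [base_x le_cost downE].
have [|y base_y [costE yup ydown]] := @reduce_down x d base_x.
  by rewrite d0 downE.
by exists y; [split=> //; rewrite costE | rewrite yup].
Qed.

Lemma MaxDR_nondecreasing_budget : nondecreasing_arg1 (MaxDR_dom I) (MaxDR I).
Proof.
move=> th th' u [_ ne] _ le_th.
apply: maximum_le (MaxDR_program I) _ ne _ => [p x [base_x _ _]|].
  exact: total_down_le base_x.
by move=> x [base_x le_cost up]; exists x => //; split=> //;
  exact: le_trans le_th.
Qed.

Lemma MaxDR_nonincreasing_up : nonincreasing_arg2 (MaxDR_dom I) (MaxDR I).
Proof.
move=> th u u' [u0 _] [_ ne] le_u.
apply: maximum_le (MaxDR_program I) _ ne _ => [p x [base_x _ _]|].
  exact: total_down_le base_x.
move=> x [base_x le_cost upE].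
have [|y base_y [costE yup ydown]] := @reduce_up x u base_x.
  by rewrite u0 upE.
by exists y; [split=> //; rewrite costE | rewrite ydown].
Qed.

End ValueFunctions.

Theorem theorem2 (R : realType) (N L D : nat) (I : network R N L D)
    (capP : forall n : 'I_N, gmin I n 0 <= gmax I n 0)
    (rampP : forall n : 'I_N, 0 <= ramp_limit I n 0)
    (feasible0 : MinC_feasible I (0, 0) !=set0) :
  [/\ {within MinC_dom I, continuous (MinC I)},
      piecewise_linear_on (MinC_dom I) (MinC I),
      convex_on (MinC_dom I) (MinC I),
      nondecreasing_arg1 (MinC_dom I) (MinC I) &
      nondecreasing_arg2 (MinC_dom I) (MinC I)] /\
  [/\ {within MaxUR_dom I, continuous (MaxUR I)},
      piecewise_linear_on (MaxUR_dom I) (MaxUR I),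
      concave_on (MaxUR_dom I) (MaxUR I),
      nondecreasing_arg1 (MaxUR_dom I) (MaxUR I) &
      nonincreasing_arg2 (MaxUR_dom I) (MaxUR I)] /\
  [/\ {within MaxDR_dom I, continuous (MaxDR I)},
      piecewise_linear_on (MaxDR_dom I) (MaxDR I),
      concave_on (MaxDR_dom I) (MaxDR I),
      nondecreasing_arg1 (MaxDR_dom I) (MaxDR I) &
      nonincreasing_arg2 (MaxDR_dom I) (MaxDR I)].
Proof.
split; last split.
- have := minimal_value_regular (MinC_program I)
    (fun _ _ '(And3 base_x _ _) => cost_ge base_x).
  rewrite -MinC_domE => -[cont pwl conv].
  by split=> //;
    [exact: MinC_nondecreasing_up | exact: MinC_nondecreasing_down].
- have := maximal_value_regular (MaxUR_program I)
    (fun _ _ '(And3 base_x _ _) => total_up_le base_x).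
  rewrite -MaxUR_domE => -[cont pwl conv].
  by split=> //;
    [exact: MaxUR_nondecreasing_budget | exact: MaxUR_nonincreasing_down].
- have := maximal_value_regular (MaxDR_program I)
    (fun _ _ '(And3 base_x _ _) => total_down_le base_x).
  rewrite -MaxDR_domE => -[cont pwl conv].
  by split=> //;
    [exact: MaxDR_nondecreasing_budget | exact: MaxDR_nonincreasing_up].
Qed.
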